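(* Let $A$ be a groupoid atlas such that $\phi_A$ is discrete (i.e. $\alpha\leqslant\beta$ implies $\alpha=\beta$). Then $H_n(A)\cong\bigoplus_{\alpha\in\phi_A}H_n(\mathcal G_\alpha)$ for all $n\geqslant 2$, and for $n=1$ one has $H_1(A)\cong\left(\bigoplus_{\alpha\in\phi_A}H_1(\mathcal G_\alpha)\right)\oplus F$ with $F$ a free abelian group.
   Context: A groupoid atlas $A=(X_A,\phi_A,\mathcal G_A)$ consists of a set $X_A$, an index set $\phi_A$ with a reflexive relation $\leqslant$, and for each $\alpha\in\phi_A$ a groupoid $\mathcal G_\alpha$ (a local groupoid) with object set $X_\alpha\subset X_A$, such that if $\alpha\leqslant\beta$ then $X_\alpha\cap X_\beta$ is a union of connected components of $\mathcal G_\alpha$ and a functor $\phi_\alpha^\beta:\mathcal G_\alpha|_{X_\alpha\cap X_\beta}\to\mathcal G_\beta|_{X_\alpha\cap X_\beta}$ which is the identity on objects is given ($\mathcal G|_X$ is the full subgroupoid on $X$); $\phi_\alpha^\alpha=\mathrm{id}$ and $\phi_\beta^\gamma\circ\phi_\alpha^\beta=\phi_\alpha^\gamma$ whenever defined. All atlases are assumed covered: $X_A=\bigcup_\alpha X_\alpha$. $A$ is regular if for each $x\in X_A$ the set $\{\alpha : x\in X_\alpha\}$ has an initial element $\alpha_x$ and each $\mathcal G_{\alpha_x}$ is the one-object one-arrow groupoid. The regularization $rA$ has $X_{rA}=X_A$, $\phi_{rA}=\phi_A\sqcup\{\alpha_x\}_{x\in X_A}$, with the relation of $\phi_A$ extended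 (reflexively) by $\alpha_x\leqslant\alpha$ iff $x\in X_\alpha$ (for $\alpha\in\phi_A$), with $\mathcal G_{\alpha_x}$ the trivial groupoid on $x$ and the other local groupoids as in $A$; $rA$ is regular. The nerve $NA$ of a regular atlas is the simplicial set whose $n$-simplices are the sequences $x_0\xrightarrow{g_1}x_1\to\cdots\xrightarrow{g_n}x_n$ with $g_1,\dots,g_n$ arrows of a common local groupoid $\mathcal G_\alpha$, modulo the equivalence relation generated by $(g_1,\dots,g_n)\sim(\phi_\alpha^\beta(g_1),\dots,\phi_\alpha^\beta(g_n))$ ($\alpha\leqslant\beta$, whenever defined), with faces and degeneracies as in the nerve of a category. For arbitrary $A$, $NA:=N(rA)$. $H_n(A)=H_n(NA;\mathbb Z)$ is the homology of the simplicial set $NA$ (the chain complex $\mathbb Z[NA_n]$ with boundary $\sum_i(-1)^id_i$), and $H_n(\mathcal G_\alpha)=H_n(N\mathcal G_\alpha;\mathbb Z)$ is the homology of the usual nerve of the groupoid $\mathcal G_\alpha$. *)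

(* Defs.v *)
From HB Require Import structures.
From mathcomp.multinomials Require Import freeg.
From mathcomp Require Import all_boot all_order all_algebra.
From mathcomp Require Import boolp classical_sets functions cardinality.
From Stdlib Require Import Relation_Operators.

Set Implicit Arguments.
Unset Strict Implicit.
Unset Printing Implicit Defensive.

Import GRing.Theory.
Local Open Scope classical_set_scope.
Local Open Scope ring_scope.
Local Open Scope quotient_scope.

(* A groupoid whose object set is a subset of the ambient set [X]; [hom x y] is
   empty unless [x] and [y] are objects.  Composition is diagrammatic. *)
Record local_groupoid (X : Type) := LocalGroupoid {
  obj : set X;
  hom : X -> X -> Type;
  hom_src : forall x y, hom x y -> obj x;
  hom_tgt : forall x y, hom x y -> obj y;
  gid : forall x, obj x -> hom x x;
  gcomp : forall x y z, hom x y -> hom y z -> hom x z;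
  ginv : forall x y, hom x y -> hom y x;
  gcompA : forall x y z t (f : hom x y) (g : hom y z) (h : hom z t),
    gcomp f (gcomp g h) = gcomp (gcomp f g) h;
  gcomp1l : forall x y (ox : obj x) (f : hom x y), gcomp (gid ox) f = f;
  gcomp1r : forall x y (oy : obj y) (f : hom x y), gcomp f (gid oy) = f;
  gcompV : forall x y (ox : obj x) (f : hom x y), gcomp f (ginv f) = gid ox;
  gcompVl : forall x y (oy : obj y) (f : hom x y), gcomp (ginv f) f = gid oy
}.

Definition component (X : Type) (G : local_groupoid X) (x : X) : set X :=
  [set y | inhabited (hom G x y)].

Definition union_of_components (X : Type) (G : local_groupoid X) (S : set X) :=
  exists2 B : set X, B `<=` obj G & S = \bigcup_(x in B) component G x.

(* An arrow of [G a] between points of [X_b] is an arrow of the full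
   subgroupoid of [G a] on [X_a `&` X_b], so [atlas_map] is a functor between
   the two full subgroupoids on [X_a `&` X_b] which is the identity on objects.
   The index relation is reflexive but not assumed transitive. *)
Record groupoid_atlas := GroupoidAtlas {
  atlas_carrier : Type;
  atlas_index : Type;
  atlas_le : atlas_index -> atlas_index -> Prop;
  atlas_le_refl : forall a, atlas_le a a;
  atlas_local : atlas_index -> local_groupoid atlas_carrier;
  atlas_components : forall a b, atlas_le a b ->
    union_of_components (atlas_local a)
      (obj (atlas_local a) `&` obj (atlas_local b));
  atlas_map : forall a b, atlas_le a b -> forall x y,
    obj (atlas_local b) x -> obj (atlas_local b) y ->
    hom (atlas_local a) x y -> hom (atlas_local b) x y;
  atlas_map_id : forall a b (ab : atlas_le a b) x
    (xa : obj (atlas_local a) x) (xb xb' : obj (atlas_local b) x),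
    atlas_map ab xb xb' (gid xa) = gid xb;
  atlas_map_comp : forall a b (ab : atlas_le a b) x y z
    (xb : obj (atlas_local b) x) (yb : obj (atlas_local b) y)
    (zb : obj (atlas_local b) z)
    (f : hom (atlas_local a) x y) (g : hom (atlas_local a) y z),
    atlas_map ab xb zb (gcomp f g) =
    gcomp (atlas_map ab xb yb f) (atlas_map ab yb zb g);
  atlas_map_refl : forall a (aa : atlas_le a a) x y
    (xa : obj (atlas_local a) x) (ya : obj (atlas_local a) y)
    (f : hom (atlas_local a) x y),
    atlas_map aa xa ya f = f;
  atlas_map_trans : forall a b c
    (ab : atlas_le a b) (bc : atlas_le b c) (ac : atlas_le a c) x y
    (xb : obj (atlas_local b) x) (yb : obj (atlas_local b) y)
    (xc : obj (atlas_local c) x) (yc : obj (atlas_local c) y)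
    (f : hom (atlas_local a) x y),
    atlas_map bc xc yc (atlas_map ab xb yb f) = atlas_map ac xc yc f;
  atlas_cover : forall x, exists a, obj (atlas_local a) x
}.

Definition discrete_index (A : groupoid_atlas) :=
  forall a b : atlas_index A, atlas_le a b -> a = b.

Section TrivialGroupoid.
Variables (X : Type) (z : X).

Definition trivial_hom (x y : X) : Prop := z = x /\ z = y.

Definition trivial_groupoid : local_groupoid X :=
  @LocalGroupoid X (fun x => z = x) trivial_hom
    (fun x y f => let: conj zx _ := f in zx)
    (fun x y f => let: conj _ zy := f in zy)
    (fun x zx => conj zx zx)
    (fun x y t f g => let: conj zx _ := f in let: conj _ zt := g in conj zx zt)
    (fun x y f => let: conj zx zy := f in conj zy zx)
    (fun _ _ _ _ _ _ _ => Prop_irrelevance _ _)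
    (fun _ _ _ _ => Prop_irrelevance _ _) (fun _ _ _ _ => Prop_irrelevance _ _)
    (fun _ _ _ _ => Prop_irrelevance _ _) (fun _ _ _ _ => Prop_irrelevance _ _).

End TrivialGroupoid.

Definition regular_atlas (A : groupoid_atlas) :=
  forall x : atlas_carrier A, exists a : atlas_index A,
    [/\ obj (atlas_local a) x,
        forall b : atlas_index A, obj (atlas_local b) x -> atlas_le a b,
        obj (atlas_local a) = [set x]
      & forall f g : hom (atlas_local a) x x, f = g].

Section Regularization.
Variable A : groupoid_atlas.

Definition reg_index : Type := (atlas_index A + atlas_carrier A)%type.

Definition reg_le (a b : reg_index) : Prop :=
  match a, b with
  | inl a, inl b => atlas_le a b
  | inr x, inl b => obj (atlas_local b) x
  | inr x, inr y => x = y
  | inl _, inr _ => False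
  end.

Definition reg_local (a : reg_index) : local_groupoid (atlas_carrier A) :=
  match a with
  | inl a => atlas_local a
  | inr x => trivial_groupoid x
  end.

Definition trivial_to_local (G : local_groupoid (atlas_carrier A)) z
    (zG : obj G z) x y (f : hom (trivial_groupoid z) x y) : hom G x y :=
  match f with
  | conj ex ey =>
    match ex in _ = x', ey in _ = y' return hom G x' y' with
    | erefl, erefl => gid zG
    end
  end.

Definition reg_map (a b : reg_index) : reg_le a b -> forall x y,
    obj (reg_local b) x -> obj (reg_local b) y ->
    hom (reg_local a) x y -> hom (reg_local b) x y :=
  match a, b return reg_le a b -> forall x y,
    obj (reg_local b) x -> obj (reg_local b) y ->
    hom (reg_local a) x y -> hom (reg_local b) x y with
  | inl a, inl b => fun ab x y xb yb f => atlas_map ab xb yb f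
  | inr z, inl b => fun zb x y _ _ f => trivial_to_local zb f
  | inr z, inr w => fun _ x y xw yw _ => conj xw yw
  | inl _, inr _ => fun ab => False_rect _ ab
  end.

Lemma reg_le_refl a : reg_le a a.
Proof. by case: a => //= a; exact: atlas_le_refl. Qed.

Lemma trivial_components (z : atlas_carrier A) (S : set (atlas_carrier A)) :
  S z ->
  union_of_components (trivial_groupoid z) (obj (trivial_groupoid z) `&` S).
Proof.
move=> Sz; exists [set z]; first by move=> x ->.
apply/seteqP; split=> [x [/= <- _]|x [_ -> [[_ <-]]]] //.
by exists z => //; constructor.
Qed.

Lemma reg_components a b : reg_le a b ->
  union_of_components (reg_local a) (obj (reg_local a) `&` obj (reg_local b)).
Proof.
case: a b => [a|x] [b|y] //= ab; first exact: atlas_components.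
  exact: trivial_components.
by apply: trivial_components; rewrite ab.
Qed.

Lemma gid_irr X (G : local_groupoid X) x (p q : obj G x) : gid p = gid q.
Proof. by rewrite (Prop_irrelevance p q). Qed.

Lemma reg_map_id a b (ab : reg_le a b) x (xa : obj (reg_local a) x)
    (xb xb' : obj (reg_local b) x) : reg_map ab xb xb' (gid xa) = gid xb.
Proof.
case: a b ab xa xb xb' => [a|z] [b|w] //= ab xa xb xb'.
  exact: atlas_map_id.
by case: _ / xa xb {xb'} => xb; exact: gid_irr.
Qed.

Lemma reg_map_comp a b (ab : reg_le a b) x y z
    (xb : obj (reg_local b) x) (yb : obj (reg_local b) y)
    (zb : obj (reg_local b) z)
    (f : hom (reg_local a) x y) (g : hom (reg_local a) y z) :
  reg_map ab xb zb (gcomp f g) =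
  gcomp (reg_map ab xb yb f) (reg_map ab yb zb g).
Proof.
case: a b ab xb yb zb f g => [a|t] [b|w] //= ab xb yb zb f g.
- exact: atlas_map_comp.
- case: f g => f1 f2 [g1 g2] /=; rewrite (Prop_irrelevance f2 g1) {f2}.
  move: g1 g2 f1 yb zb xb; case: _ / => g2; case: _ / g2 => f1.
  by case: _ / f1 => *; rewrite gcomp1l.
Qed.

Lemma reg_map_refl a (aa : reg_le a a) x y
    (xa : obj (reg_local a) x) (ya : obj (reg_local a) y)
    (f : hom (reg_local a) x y) : reg_map aa xa ya f = f.
Proof.
case: a aa xa ya f => [a|t] //= aa xa ya f; exact: atlas_map_refl.
Qed.

Lemma reg_map_trans a b c (ab : reg_le a b) (bc : reg_le b c) (ac : reg_le a c)
    x y (xb : obj (reg_local b) x) (yb : obj (reg_local b) y)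
    (xc : obj (reg_local c) x) (yc : obj (reg_local c) y)
    (f : hom (reg_local a) x y) :
  reg_map bc xc yc (reg_map ab xb yb f) = reg_map ac xc yc f.
Proof.
case: a b c ab bc ac xb yb xc yc f => [a|t] [b|u] [c|v] //=;
  move=> ab bc ac xb yb xc yc f.
- exact: atlas_map_trans.
- case: f => f1 f2; case: _ / f1 xb xc => xb xc; case: _ / f2 yb yc => yb yc /=.
  by rewrite atlas_map_id; exact: gid_irr.
- case: f => f1 f2 /=; move: f1 f2 bc xb yb xc yc.
  case: _ / ab => f1 f2 bc xb yb.
  rewrite (Prop_irrelevance f1 xb) (Prop_irrelevance f2 yb).
  by rewrite (Prop_irrelevance bc ac).
Qed.

Lemma reg_cover x : exists a, obj (reg_local a) x.
Proof. by exists (inr x). Qed.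

Definition regularization : groupoid_atlas :=
  GroupoidAtlas reg_le_refl reg_components reg_map_id reg_map_comp
    reg_map_refl reg_map_trans reg_cover.

Lemma regularization_regular : regular_atlas regularization.
Proof.
move=> x; exists (inr x); split=> //=.
- by move=> [b|y].
- by apply/seteqP; split=> y /=.
Qed.

End Regularization.

(* The face map [d_i] omits the [i]-th vertex. *)
Record simplicial_set := SimplicialSet {
  simp :> nat -> choiceType;
  face : forall n, 'I_n.+2 -> simp n.+1 -> simp n;
  degen : forall n, 'I_n.+1 -> simp n -> simp n.+1;
  face_face : forall n (i j : 'I_n.+2) (s : simp n.+2), (i <= j)%N ->
    face i (face (lift ord0 j) s) = face j (face (widen_ord (leqnSn _) i) s);
  face_degen_lt : forall n (i : 'I_n.+2) (j : 'I_n.+1) (s : simp n.+1),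
    (i <= j)%N ->
    face (widen_ord (leqnSn _) i) (degen (lift ord0 j) s) = degen j (face i s);
  face_degen_eq : forall n (i : 'I_n.+2) (j : 'I_n.+1) (s : simp n),
    (i == j :> nat) || (i == j.+1 :> nat) -> face i (degen j s) = s;
  face_degen_gt : forall n (i : 'I_n.+2) (j : 'I_n.+1) (s : simp n.+1),
    (j < i)%N ->
    face (lift ord0 i) (degen (widen_ord (leqnSn _) j) s) = degen j (face i s);
  degen_degen : forall n (i j : 'I_n.+1) (s : simp n), (i <= j)%N ->
    degen (widen_ord (leqnSn _) i) (degen j s) = degen (lift ord0 j) (degen i s)
}.

Section GroupoidNerve.
Variables (X : Type) (G : local_groupoid X).

(* [string n x]: sequences of [n] composable arrows of [G] starting at [x]. *)
Fixpoint string (n : nat) (x : X) : Type :=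
  if n is m.+1 then {y : X & (hom G x y * string m y)%type} else obj G x.

Definition string_src n x : string n x -> obj G x :=
  match n return string n x -> obj G x with
  | 0 => fun c => c
  | _.+1 => fun c => hom_src (projT2 c).1
  end.

(* [inner_face i] is [d_(i+1)]: it composes the arrows [i] and [i+1] (counting
   from 0), or omits the last arrow if there is no arrow [i+1]. *)
Fixpoint inner_face (n : nat) (x : X) (i : nat) :
    string n.+1 x -> string n x :=
  match n return string n.+1 x -> string n x with
  | 0 => fun c => string_src c
  | m.+1 => fun c =>
    match i with
    | 0 => let c' := (projT2 c).2 in
           existT _ (projT1 c')
             (gcomp (projT2 c).1 (projT2 c').1, (projT2 c').2)
    | k.+1 => existT _ (projT1 c) ((projT2 c).1, inner_face k (projT2 c).2)
    end
  end.

(* [string_degen i] inserts an identity at vertex [i]; the values for [i > n]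
   are irrelevant. *)
Fixpoint string_degen (n : nat) (x : X) (i : nat) :
    string n x -> string n.+1 x :=
  match n, i return string n x -> string n.+1 x with
  | m.+1, k.+1 => fun c =>
      existT _ (projT1 c) ((projT2 c).1, string_degen k (projT2 c).2)
  | _, _ => fun c => existT _ x (gid (string_src c), c)
  end.

Definition simplex (n : nat) : Type := {x : X & string n x}.

HB.instance Definition _ n := gen_eqMixin (simplex n).
HB.instance Definition _ n := gen_choiceMixin (simplex n).

Definition simplex_face n (i : nat) (s : simplex n.+1) : simplex n :=
  match i with
  | 0 => existT _ (projT1 (projT2 s)) (projT2 (projT2 s)).2
  | k.+1 => existT _ (projT1 s) (inner_face k (projT2 s))
  end.

Definition simplex_degen n (i : nat) (s : simplex n) : simplex n.+1 :=
  existT _ (projT1 s) (string_degen i (projT2 s)).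

Lemma string_cons n x y (f : hom G x y) (c c' : string n y) : c = c' ->
  existT _ y (f, c) = existT _ y (f, c') :> string n.+1 x.
Proof. by move=> ->. Qed.

Lemma string_degen0 n x (p q : obj G x) (c : string n x) :
  existT _ x (gid p, c) = existT _ x (gid q, c) :> string n.+1 x.
Proof. by rewrite (gid_irr p q). Qed.

Lemma simplex_face_face n i j (s : simplex n.+2) : (i <= j <= n.+1)%N ->
  simplex_face i (simplex_face j.+1 s) = simplex_face j (simplex_face i s).
Proof.
case: s => x c /andP[]; case: i j => [|i] [|j] //= ij jn.
congr existT.
elim: n x c i j ij jn => [|n IH] x [y [f [z [g c]]]] i j ij jn /=.
  exact: Prop_irrelevance.
case: i j ij jn => [|i] [|j] //= ij jn.
- by case: c => t [h c] /=; rewrite gcompA.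
exact: (string_cons f (IH _ (existT _ z (g, c)) i j ij jn)).
Qed.

Lemma simplex_face_degen_lt n i j (s : simplex n.+1) : (i <= j <= n)%N ->
  simplex_face i (simplex_degen j.+1 s) = simplex_degen j (simplex_face i s).
Proof.
case: s => x c /andP[]; case: i => [|i] //= ij jn.
congr existT; case: j ij jn => // j; rewrite ltnS => ij jn.
elim: n x c i j ij jn => [|n IH] x [y [f c]] i j ij jn //=.
case: i j ij jn => [|i] [|j] // ij jn.
exact: (string_cons f (IH _ c i j ij jn)).
Qed.

Lemma simplex_face_degen_eq n i j (s : simplex n) : (j <= n)%N ->
  (i == j) || (i == j.+1) -> simplex_face i (simplex_degen j s) = s.
Proof.
case: s => x c; move=> jn; case: i => [|i] /=.
  by rewrite orbF => /eqP <-; case: n c jn.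
rewrite eqSS /simplex_face /simplex_degen /= => ij; congr existT.
elim: n x c i j ij jn => [|n IH] x c i j ij jn.
  by case: j ij jn => //= *; exact: Prop_irrelevance.
case: c => y [f c]; case: j i ij jn => [|j] [|i] // ij jn.
- by rewrite /= gcomp1l.
- by case: j ij {jn} => // _; case: n {IH} c => [|n] c /=; rewrite gcomp1r.
- exact: (string_cons f (IH _ c i j ij jn)).
Qed.

Lemma inner_face_degen_gt n x i j (c : string n.+1 x) : (j <= i <= n)%N ->
  inner_face i.+1 (string_degen j c) = string_degen j (inner_face i c).
Proof.
move=> /andP[]; elim: n x c i j => [|n IH] x [y [f c]] i j ji iN.
  by case: i j ji iN => [|i] [|j] //= *; exact: string_degen0.
case: j ji => [_|j]; last first.
  by case: i iN => // i iN ji; exact: (string_cons f (IH _ c i j ji iN)).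
set d : string n.+2 x := existT _ y (f, c).
exact: (string_degen0 _ (string_src (inner_face i d)) (inner_face i d)).
Qed.

Lemma simplex_face_degen_gt n i j (s : simplex n.+1) : (j < i <= n.+1)%N ->
  simplex_face i.+1 (simplex_degen j s) = simplex_degen j (simplex_face i s).
Proof.
case: s => x c; case: i => [|i] // ijn.
by apply: (congr1 (existT _ x)); exact: inner_face_degen_gt.
Qed.

Lemma simplex_degen_degen n i j (s : simplex n) : (i <= j <= n)%N ->
  simplex_degen i (simplex_degen j s) = simplex_degen j.+1 (simplex_degen i s).
Proof.
case: s => x c /andP[ij jn]; apply: (congr1 (existT _ x)).
have i0 m z k (d : string m z) :
    string_degen 0 (string_degen k d) = string_degen k.+1 (string_degen 0 d).
  have -> : string_degen 0 d = existT _ z (gid (string_src d), d).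
    by case: m d.
  exact: (string_degen0 _ _ (string_degen k d)).
elim: n x c i j ij jn => [|n IH] x c [|i] [|j] // ij jn; try exact: i0.
case: c => y [f c]; exact: (string_cons f (IH _ c i j ij jn)).
Qed.

Definition groupoid_nerve : simplicial_set.
Proof.
refine (@SimplicialSet (fun n => simplex n) (fun n i => @simplex_face n i)
  (fun n i => @simplex_degen n i) _ _ _ _ _) => n i j s ij.
- by apply: simplex_face_face; rewrite ij -ltnS ltn_ord.
- by apply: simplex_face_degen_lt; rewrite ij -ltnS ltn_ord.
- by apply: simplex_face_degen_eq; rewrite // -ltnS ltn_ord.
- by apply: simplex_face_degen_gt; rewrite ij -ltnS ltn_ord.
- by apply: simplex_degen_degen; rewrite ij -ltnS ltn_ord.
Defined.

(* All the vertices of the string lie in [S]. *)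
Fixpoint string_in (S : set X) (n : nat) (x : X) : string n x -> Prop :=
  match n return string n x -> Prop with
  | 0 => fun _ => S x
  | m.+1 => fun c => S x /\ string_in S (projT2 c).2
  end.

Definition string_in_src (S : set X) n x : forall c : string n x,
    string_in S c -> S x :=
  match n return forall c : string n x, string_in S c -> S x with
  | 0 => fun _ xS => xS
  | _.+1 => fun _ cS => let: conj xS _ := cS in xS
  end.

End GroupoidNerve.

Section StringMap.
Variables (X : Type) (G H : local_groupoid X).
Variable F : forall x y, obj H x -> obj H y -> hom G x y -> hom H x y.

Fixpoint string_map (n : nat) (x : X) :
    forall c : string G n x, string_in (obj H) c -> string H n x :=
  match n return
    forall c : string G n x, string_in (obj H) c -> string H n x with
  | 0 => fun _ xH => xH
  | m.+1 => fun c cH =>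
      let: conj xH tH := cH in
      existT _ (projT1 c)
        (F xH (string_in_src tH) (projT2 c).1, string_map tH)
  end.

Hypothesis F_id : forall x (xG : obj G x) (xH xH' : obj H x),
  F xH xH' (gid xG) = gid xH.
Hypothesis F_comp : forall x y z (xH : obj H x) (yH : obj H y) (zH : obj H z)
    (f : hom G x y) (g : hom G y z),
  F xH zH (gcomp f g) = gcomp (F xH yH f) (F yH zH g).

Lemma string_map_cons n x y (xH : obj H x) (p q : obj H y) (f : hom G x y)
    (c d : string H n y) : c = d ->
  existT _ y (F xH p f, c) = existT _ y (F xH q f, d) :> string H n.+1 x.
Proof. by move=> ->; rewrite (Prop_irrelevance p q). Qed.

Lemma inner_face_map n x i (c : string G n.+1 x) (cH : string_in (obj H) c) :
  exists p : string_in (obj H) (inner_face i c),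
    inner_face i (string_map cH) = string_map p.
Proof.
elim: n x i c cH => [|n IH] x i [y [f c]] [xH tH].
  by exists xH; exact: (@Prop_irrelevance (obj H x)).
case: i => [|i].
  case: c tH => z [g c] [yH tH]; exists (conj xH tH) => /=.
  by rewrite (F_comp xH yH).
case: (IH y i c tH) => p E; exists (conj xH p).
exact: (string_map_cons xH _ _ f E).
Qed.

Lemma string_degen_map n x i (c : string G n x) (cH : string_in (obj H) c) :
  exists p : string_in (obj H) (string_degen i c),
    string_degen i (string_map cH) = string_map p.
Proof.
have i0 m z (d : string G m z) (dH : string_in (obj H) d) :
    exists p : string_in (obj H) (string_degen 0 d),
      string_degen 0 (string_map dH) = string_map p.
  have E p q r e : existT _ z (gid p, e) =
      existT _ z (F q r (gid (string_src d)), e) :> string H m.+1 z.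
    by rewrite F_id; exact: string_degen0.
  by case: m d dH E => [|m] d dH E;
    exists (conj (string_in_src dH) dH); exact: E.
elim: n x i c cH => [|n IH] x i c cH; first by case: i => [|i]; exact: i0.
case: i => [|i]; first exact: i0.
case: c cH => y [f c] [xH tH]; case: (IH y i c tH) => p E.
exists (conj xH p).
exact: (string_map_cons xH _ _ f E).
Qed.

End StringMap.

Section AtlasNerve.
Variable A : groupoid_atlas.

Definition local_simplex (n : nat) : Type :=
  {a : atlas_index A & simplex (atlas_local a) n}.

HB.instance Definition _ n := gen_eqMixin (local_simplex n).
HB.instance Definition _ n := gen_choiceMixin (local_simplex n).

(* A string of [a] all of whose vertices also lie in [X_b] is identified with
   its image under [atlas_map ab]. *)
Variant simplex_step (n : nat) : local_simplex n -> local_simplex n -> Prop :=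
  SimplexStep (a b : atlas_index A) (ab : atlas_le a b) (x : atlas_carrier A)
    (c : string (atlas_local a) n x) (cb : string_in (obj (atlas_local b)) c) :
    simplex_step (existT _ a (existT _ x c))
      (existT _ b (existT _ x (string_map (atlas_map ab) cb))).

Definition simplex_equiv (n : nat) (s t : local_simplex n) : bool :=
  `[< clos_refl_sym_trans _ (@simplex_step n) s t >].

Lemma simplex_equiv_class n : equiv_class_of (@simplex_equiv n).
Proof.
split=> [s|s t|t s u].
- by apply/asboolP; exact: rst_refl.
- by apply/asboolP/asboolP => st; exact: rst_sym.
- by move=> /asboolP st /asboolP tu; apply/asboolP; apply: rst_trans st tu.
Qed.

Canonical simplex_equiv_rel n := EquivRelPack (simplex_equiv_class n).
Canonical simplex_equiv_encModRel n := defaultEncModRel (@simplex_equiv n).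

Definition atlas_simplex (n : nat) := {eq_quot (@simplex_equiv n)}.

HB.instance Definition _ n := Choice.on (atlas_simplex n).
HB.instance Definition _ n :
    EqQuotient _ (@simplex_equiv n) (atlas_simplex n) :=
  EqQuotient.on (atlas_simplex n).

Definition local_face n (i : nat) (s : local_simplex n.+1) : local_simplex n :=
  existT _ (projT1 s) (simplex_face i (projT2 s)).

Definition local_degen n (i : nat) (s : local_simplex n) : local_simplex n.+1 :=
  existT _ (projT1 s) (simplex_degen i (projT2 s)).

Definition atlas_face n (i : nat) : atlas_simplex n.+1 -> atlas_simplex n :=
  lift_fun1 (atlas_simplex n.+1)
    (fun s => \pi_(atlas_simplex n) (local_face i s)).

Definition atlas_degen n (i : nat) : atlas_simplex n -> atlas_simplex n.+1 :=
  lift_fun1 (atlas_simplex n)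
    (fun s => \pi_(atlas_simplex n.+1) (local_degen i s)).

Lemma simplex_equiv_morph m n (f : local_simplex m -> local_simplex n) :
  (forall s t, simplex_step s t -> simplex_step (f s) (f t)) ->
  forall s t, simplex_equiv s t -> simplex_equiv (f s) (f t).
Proof.
move=> fstep s t /asboolP st; apply/asboolP; elim: {s t} st.
- by move=> s t /fstep; exact: rst_step.
- by move=> s; exact: rst_refl.
- by move=> s t _; exact: rst_sym.
- by move=> s t u _ + _; exact: rst_trans.
Qed.

Lemma local_face_step n i (s t : local_simplex n.+1) :
  simplex_step s t -> simplex_step (local_face i s) (local_face i t).
Proof.
case=> a b ab x c cb; case: i => [|i].
  by case: c cb => y [f c] [xb tb]; exact: SimplexStep.
have [p E] := inner_face_map (@atlas_map_comp _ _ _ ab) i cb.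
by rewrite /local_face /simplex_face /= E; exact: SimplexStep.
Qed.

Lemma local_degen_step n i (s t : local_simplex n) :
  simplex_step s t -> simplex_step (local_degen i s) (local_degen i t).
Proof.
case=> a b ab x c cb.
have [p E] := string_degen_map (@atlas_map_id _ _ _ ab) i cb.
by rewrite /local_degen /simplex_degen /= E; exact: SimplexStep.
Qed.

Lemma pi_atlas_face n i (s : local_simplex n.+1) :
  atlas_face i (\pi_(atlas_simplex n.+1) s) =
  \pi_(atlas_simplex n) (local_face i s).
Proof.
rewrite /atlas_face; unlock; apply/eqmodP.
apply: (simplex_equiv_morph (@local_face_step n i)).
by apply/eqmodP; rewrite reprK.
Qed.

Lemma pi_atlas_degen n i (s : local_simplex n) :
  atlas_degen i (\pi_(atlas_simplex n) s) =
  \pi_(atlas_simplex n.+1) (local_degen i s).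
Proof.
rewrite /atlas_degen; unlock; apply/eqmodP.
apply: (simplex_equiv_morph (@local_degen_step n i)).
by apply/eqmodP; rewrite reprK.
Qed.

(* The construction makes sense for every atlas, but it is the nerve only of a
   regular one; [nerve] below applies it to the regularization. *)
Definition regular_nerve : simplicial_set.
Proof.
refine (@SimplicialSet (fun n => atlas_simplex n) (fun n i => @atlas_face n i)
  (fun n i => @atlas_degen n i) _ _ _ _ _) => n i j s ij;
  elim/quotW: s => -[a s]; rewrite !(pi_atlas_face, pi_atlas_degen);
  congr (\pi_(atlas_simplex _) (existT _ a _)).
- exact: (@face_face (groupoid_nerve (atlas_local a))).
- exact: (@face_degen_lt (groupoid_nerve (atlas_local a))).
- exact: (@face_degen_eq (groupoid_nerve (atlas_local a))).
- exact: (@face_degen_gt (groupoid_nerve (atlas_local a))).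
- exact: (@degen_degen (groupoid_nerve (atlas_local a))).
Defined.

End AtlasNerve.

Definition nerve (A : groupoid_atlas) : simplicial_set :=
  regular_nerve (regularization A).

Section Homology.
Variable S : simplicial_set.

Definition chain (n : nat) : Type := {freeg (S n) / int}.

HB.instance Definition _ n := GRing.Lmodule.on (chain n).

Definition boundary (n : nat) : chain n.+1 -> chain n :=
  fglift (fun s => \sum_(i < n.+2) << (-1) ^+ i *g face i s >>).

Lemma boundary_is_zmod_morphism n : zmod_morphism (@boundary n).
Proof. exact: lift_is_additive. Qed.

HB.instance Definition _ n := GRing.isZmodMorphism.Build _ _ (@boundary n)
  (@boundary_is_zmod_morphism n).

Lemma boundaryU n k (s : S n.+1) :
  boundary (<< k *g s >> : chain n.+1) =
  \sum_(i < n.+2) << k * (-1) ^+ i *g face i s >>.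
Proof.
rewrite /boundary liftU scaler_sumr; apply: eq_bigr => i _.
by apply/eqP/freeg_eqP => t; rewrite coeffZ !coeffU mulrA.
Qed.

Lemma boundary_boundary n (c : chain n.+2) : boundary (boundary c) = 0.
Proof.
rewrite -[c]freeg_sumE !raddf_sum big1 // => s _; move: (coeff s c) => k {c}.
rewrite /= boundaryU raddf_sum.
under eq_bigr => j _.
  rewrite /= boundaryU (bigID (fun i : 'I__ => (i < j)%N)) /=; over.
rewrite big_split /= big_ord_recl /= [X in (X + _) + _]big_pred0 // add0r.
rewrite [X in _ + X]big_ord_recr /= [X in _ + (_ + X)]big_pred0 ?addr0;
  last first.
  by move=> i; rewrite /= ltn_ord.
rewrite [X in X + _](exchange_big_dep predT) //= -big_split big1 // => j _ /=.
rewrite [X in _ + X](eq_bigl (fun i : 'I_n.+2 => (j <= i)%N)); last first.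
  by move=> i; rewrite -leqNgt.
rewrite [X in X + _](eq_bigl (fun i : 'I_n.+2 => (j <= i)%N)); last first.
  by [].
rewrite -big_split big1 // => i ji /=.
rewrite face_face // /bump leq0n addnC addn1 exprS mulN1r mulrN mulNr.
by rewrite mulrAC -freegUN addNr.
Qed.

Definition cycle_pred (n : nat) : {pred chain n} :=
  match n with
  | 0 => fun _ => true
  | m.+1 => fun c => @boundary m c == 0
  end.
Arguments cycle_pred n _ : clear implicits.

Lemma cycle_pred_closed n : zmod_closed (cycle_pred n).
Proof.
case: n => [|n] //; split=> [|x y]; rewrite !unfold_in /= ?raddf0 //.
by move=> /eqP x0 /eqP y0; rewrite raddfB /= x0 y0 subr0.
Qed.

HB.instance Definition _ n :=
  GRing.isZmodClosed.Build (chain n) (cycle_pred n) (cycle_pred_closed n).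

Record cycles (n : nat) := Cycles {
  cycle_val :> chain n;
  _ : cycle_pred n cycle_val
}.

HB.instance Definition _ n := [isSub for @cycle_val n].
HB.instance Definition _ n := [Choice of cycles n by <:].
HB.instance Definition _ n := [SubChoice_isSubZmodule of cycles n by <:].

Definition boundary_pred (n : nat) : {pred cycles n} :=
  fun z => `[< exists c : chain n.+1, boundary c = z >].

Lemma boundary_pred_closed n : zmod_closed (@boundary_pred n).
Proof.
split=> [|x y]; rewrite !unfold_in.
  by apply/asboolP; exists 0; rewrite raddf0.
move=> /asboolP[c cx] /asboolP[d dy]; apply/asboolP; exists (c - d).
by rewrite raddfB /= cx dy.
Qed.

HB.instance Definition _ n :=
  GRing.isZmodClosed.Build (cycles n) (@boundary_pred n)
    (@boundary_pred_closed n).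

Definition homology (n : nat) : zmodType :=
  @Quotient.quot (cycles n) (@boundary_pred n).

End Homology.

Section DirectSum.
Variables (I : Type) (M : I -> zmodType).

Record direct_sum := DirectSum {
  dsum_val :> forall i, M i;
  dsum_finite : finite_set [set i | dsum_val i != 0]
}.

HB.instance Definition _ := gen_eqMixin direct_sum.
HB.instance Definition _ := gen_choiceMixin direct_sum.

Lemma direct_sumP (u v : direct_sum) : (forall i, u i = v i) -> u = v.
Proof.
case: u v => [u ufin] [v vfin] /= uv.
have {}uv : u = v by apply: functional_extensionality_dep.
by case: _ / uv vfin => vfin; congr DirectSum; exact: Prop_irrelevance.
Qed.

Lemma dsum_zero_finite : finite_set [set i | (0 : M i) != 0].
Proof.
by rewrite (_ : mkset _ = set0) //; apply/seteqP; split=> i //=; rewrite eqxx.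
Qed.

Lemma dsum_opp_finite (u : direct_sum) : finite_set [set i | - u i != 0].
Proof.
by apply: sub_finite_set (dsum_finite u) => i /=; rewrite oppr_eq0.
Qed.

Lemma dsum_add_finite (u v : direct_sum) : finite_set [set i | u i + v i != 0].
Proof.
have fin : finite_set ([set i | u i != 0] `|` [set i | v i != 0]).
  by rewrite finite_setU; split; exact: dsum_finite.
apply: sub_finite_set fin => i /= uv0.
by have [u0|] := eqVneq (u i) 0; [right; rewrite u0 add0r in uv0|left].
Qed.

Definition dsum_zero := DirectSum dsum_zero_finite.
Definition dsum_opp (u : direct_sum) := DirectSum (dsum_opp_finite u).
Definition dsum_add (u v : direct_sum) := DirectSum (dsum_add_finite u v).

Lemma dsum_addA : associative dsum_add.
Proof. by move=> u v w; apply: direct_sumP => i /=; rewrite addrA. Qed.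

Lemma dsum_addC : commutative dsum_add.
Proof. by move=> u v; apply: direct_sumP => i /=; rewrite addrC. Qed.

Lemma dsum_add0 : left_id dsum_zero dsum_add.
Proof. by move=> u; apply: direct_sumP => i /=; rewrite add0r. Qed.

Lemma dsum_addN : left_inverse dsum_zero dsum_opp dsum_add.
Proof. by move=> u; apply: direct_sumP => i /=; rewrite addNr. Qed.

HB.instance Definition _ :=
  GRing.isZmodule.Build direct_sum dsum_addA dsum_addC dsum_add0 dsum_addN.

End DirectSum.

Definition isomorphic (U V : zmodType) : Prop :=
  exists f : {additive U -> V}, bijective f.

Definition free_abelian (F : zmodType) : Prop :=
  exists B : choiceType, isomorphic F {freeg B / int}.

Definition atlas_homology (A : groupoid_atlas) (n : nat) : zmodType :=
  homology (nerve A) n.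

Definition groupoid_homology (X : Type) (G : local_groupoid X) (n : nat) :
  zmodType := homology (groupoid_nerve G) n.

(* Main.v *)
From HB Require Import structures.
From mathcomp.multinomials Require Import freeg.
Require Import Defs.
From mathcomp Require Import all_boot all_algebra.
From mathcomp Require Import boolp classical_sets functions cardinality.
From mathcomp Require wochoice.
From mathcomp Require Import ring.
From Stdlib Require Import Relation_Operators.

(** Over a discrete index set, two simplices of local groupoids are identified
    in the nerve only when both are iterated degeneracies of vertices: the
    relation of the regularization merely forces the copies of a point [x] in
    the various [X_a] to coincide.  So the nerve [NA] is obtained from the
    disjoint union [D] of the nerves of the local groupoids by gluing vertices
    ([nerve_quotient_surj], [nerve_quotient_glue]).

    On chains, the quotient map [C(D) -> C(NA)] is onto, and its kernel [K] is
    made of combinations of degenerate simplices over single vertices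
    ([glue_kernel]).  In degree [n] it is a copy of [K_0], and the boundary
    [K_(n+1) -> K_n] is the alternating sum of [n + 2] identities: the identity
    for [n] odd, zero for [n] even ([boundary_const]).  Thus [K] has no homology
    in positive degrees and [H_0(K) = K_0].  The long exact sequence of
    [0 -> K -> C(D) -> C(NA) -> 0] then gives [H_n(D) = H_n(NA)] for [n >= 2]
    ([glue_homology]) and, in low degrees, the exact sequence
      [0 -> H_1(D) -> H_1(NA) -> K_0],
    where [K_0] is a subgroup of the free abelian group [C_0(D)].

    A subgroup of a free abelian group is free ([free_abelian_sub]), so the
    image [F] of [H_1(NA)] is free and the extension splits ([split_extension]),
    whence [H_1(NA) = H_1(D) + F] ([glue_homology1]).  Finally the homology of
    the disjoint union [D] is the direct sum of the homologies of its pieces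
    ([homology_coproduct]). *)

Set Implicit Arguments.
Unset Strict Implicit.
Unset Printing Implicit Defensive.

Import GRing.Theory.
Local Open Scope classical_set_scope.
Local Open Scope ring_scope.
Local Open Scope quotient_scope.

(** * Isomorphisms of abelian groups *)

Lemma isomorphic_sym (U V : zmodType) : isomorphic U V -> isomorphic V U.
Proof.
move=> [f [g fK gK]].
have g_additive : zmod_morphism g.
  by move=> x y; apply: (can_inj fK); rewrite raddfB !gK.
pose G := GRing.isZmodMorphism.Build _ _ g g_additive.
pose g' : {additive V -> U} := HB.pack g G.
by exists g', f.
Qed.

Lemma isomorphic_trans (U V W : zmodType) :
  isomorphic U V -> isomorphic V W -> isomorphic U W.
Proof.
move=> [f f_bij] [g g_bij]; exists (g \o f : {additive U -> W}).
exact: bij_comp.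
Qed.

Lemma isomorphic_inj_surj (U V : zmodType) (f : {additive U -> V}) :
  (forall u, f u = 0 -> u = 0) -> (forall v, exists u, f u = v) ->
  isomorphic U V.
Proof.
move=> f_inj f_surj; exists f; rewrite -setTT_bijective; split=> //.
- by move=> u v _ _ uv; apply/subr0_eq/f_inj; rewrite raddfB uv subrr.
- by move=> v _; have [u <-] := f_surj v; exists u.
Qed.

Lemma isomorphic_prodl (U V W : zmodType) :
  isomorphic U V -> isomorphic (U * W)%type (V * W)%type.
Proof.
move=> [f [g fK gK]]; pose h (x : U * W) := (f x.1, x.2).
have h_additive : zmod_morphism h by move=> x y; rewrite /h /= raddfB.
pose HA := GRing.isZmodMorphism.Build _ _ h h_additive.
exists (HB.pack h HA : {additive U * W -> V * W}).
by exists (fun x => (g x.1, x.2)) => -[x w]; rewrite /= /h /= ?fK ?gK.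
Qed.

(** * Additive maps out of free abelian groups *)

Section FreeExtension.
Variables (K : choiceType).

Section Extend.
Variables (M : zmodType) (f : K -> M).

(** [M] is only an abelian group, so [fglift] is applied to [M] seen as a
    module over the integers. *)
Definition extend (c : {freeg K / int}) : M := @fglift int (zmodule M) K f c.

Lemma extend_is_zmod_morphism : zmod_morphism extend.
Proof. exact: (@lift_is_additive int K (zmodule M)). Qed.

HB.instance Definition _ :=
  GRing.isZmodMorphism.Build _ _ extend extend_is_zmod_morphism.

Lemma extendZ (k : int) (x : K) : extend << k *g x >> = f x *~ k.
Proof. exact: (@liftU int (zmodule M) K). Qed.

Lemma extendU (x : K) : extend << x >> = f x.
Proof. by rewrite extendZ mulr1z. Qed.

Lemma extendE (c : {freeg K / int}) :
  extend c = \sum_(x <- dom c) f x *~ coeff x c.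
Proof.
rewrite -{1}[c]freeg_sumE raddf_sum /=.
by apply: eq_bigr => x _; rewrite extendZ.
Qed.

End Extend.

Lemma freeg_additive_ext (M : zmodType)
    (f g : {additive {freeg K / int} -> M}) :
  (forall x, f << x >> = g << x >>) -> f =1 g.
Proof.
move=> fg c; rewrite -[c]freeg_sumE !raddf_sum; apply: eq_bigr => x _.
by rewrite -[coeff x c]intz -freegU_mulz !raddfMz fg.
Qed.

End FreeExtension.

Section Push.
Variables (K L : choiceType) (g : K -> L).

Definition push : {freeg K / int} -> {freeg L / int} :=
  extend (fun x => << g x >>).

HB.instance Definition _ := GRing.Additive.on push.

Lemma pushU x : push << x >> = << g x >>.
Proof. exact: extendU. Qed.

End Push.

Lemma push_comp (K L M : choiceType) (g : K -> L) (h : L -> M) c :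
  push h (push g c) = push (h \o g) c.
Proof.
by move: c; apply: (@freeg_additive_ext _ _ (push h \o push g)) => x;
  rewrite /= !pushU.
Qed.

Lemma push_id (K : choiceType) (g : K -> K) c :
  {in dom c, g =1 id} -> push g c = c.
Proof.
move=> g_id; rewrite -{2}[c]freeg_sumE /push extendE.
apply: eq_big_seq => x /g_id ->.
by rewrite freegU_mulz intz.
Qed.

(** * Subgroups of free abelian groups *)

Section SubgroupOfFree.
Variables (B : choiceType) (F : zmodType) (j : {additive F -> {freeg B / int}}).
Hypothesis j_inj : forall x, j x = 0 -> x = 0.

Let R : rel B := sval (wochoice.well_ordering_principle B).

Let R_wo : wochoice.well_order R.
Proof. by rewrite /R; case: (wochoice.well_ordering_principle B). Qed.

Let R_min (P : B -> Prop) : (exists b, P b) ->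
  exists2 m, P m & forall b, P b -> R m b.
Proof.
move=> [b Pb].
have [|m [[/asboolP Pm m_min] _]] := @R_wo (fun b => `[< P b >]).
  by exists b; apply/asboolP.
by exists m => // c Pc; apply: m_min; apply/asboolP.
Qed.

Let R_refl b : R b b.
Proof.
by have [m <- m_min] := @R_min (eq b) (ex_intro _ b erefl); exact: m_min.
Qed.

Let R_total b c : R b c || R c b.
Proof.
have [|m [->|->] m_min] := @R_min (fun x => x = b \/ x = c).
- by exists b; left.
- by rewrite m_min //; right.
- by rewrite (m_min b) ?orbT //; left.
Qed.

Let R_anti b c : R b c -> R c b -> b = c.
Proof.
move=> bc cb.
have [|m [_ m_uniq]] := @R_wo (fun x => `[< x = b \/ x = c >]).
  by exists b; apply/asboolP; left.
rewrite -(m_uniq b) ?(m_uniq c) //; split; do ?[by apply/asboolP; auto];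
  by move=> x /asboolP[] ->.
Qed.

Let R_trans b c d : R b c -> R c d -> R b d.
Proof.
move=> bc cd; have [|m m_in m_min] := @R_min (fun x => x \in [:: b; c; d]).
  by exists b; rewrite mem_head.
have mb : R m b by apply: m_min; rewrite !inE eqxx.
have mc : R m c by apply: m_min; rewrite !inE eqxx orbT.
have md : R m d by apply: m_min; rewrite !inE eqxx !orbT.
move: m_in; rewrite !inE => /or3P[] /eqP E; subst m => //.
- by rewrite (R_anti bc mb).
- by rewrite -(R_anti cd mc).
Qed.

Let R_max (s : seq B) : s != [::] ->
  exists2 m, m \in s & {in s, forall b, R b m}.
Proof.
elim: s => // b [_ _|c s IH _].
  by exists b; rewrite ?mem_head // => c; rewrite inE => /eqP ->.
have [//|m ms m_max] := IH.
have [bm|mb] := orP (R_total b m).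
  exists m; first by rewrite inE ms orbT.
  by move=> x; rewrite inE => /predU1P[->|/m_max].
exists b; first exact: mem_head.
move=> x; rewrite inE => /predU1P[->|/m_max xm]; first exact: R_refl.
exact: R_trans xm mb.
Qed.

Let below (b : B) (x : F) := forall c, coeff c (j x) != 0 -> R c b.

Let belowB b x y : below b x -> below b y -> below b (x - y).
Proof.
move=> xb yb c; rewrite raddfB coeffB.
have [x0|/xb //] := eqVneq (coeff c (j x)) 0.
by rewrite x0 sub0r oppr_eq0 => /yb.
Qed.

Let belowMz b x k : below b x -> below b (x *~ k).
Proof.
move=> xb c; rewrite !raddfMz /= => xk; apply: xb; apply: contraNneq xk => ->.
by rewrite mul0rz.
Qed.

(** The coefficients at [b] of the elements of [F] supported up to [b] form an
    ideal of the integers; [g] realizes a generator of it. *)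
Let leading_gen (b : B) : exists g : F, below b g /\
  forall x, below b x -> (coeff b (j g) %| coeff b (j x))%Z.
Proof.
have [[x0 x0b x0_neq0]|all0] :=
  pselect (exists2 x, below b x & coeff b (j x) != 0); last first.
  exists 0; split=> [c|x xb]; first by rewrite raddf0 coeff0 eqxx.
  rewrite raddf0 coeff0 dvd0z; apply: contrapT => /negP x_neq0.
  by apply: all0; exists x.
(* A value of least positive absolute value divides the others, by Euclidean
   division. *)
pose P n := `[< exists2 x, below b x & `|coeff b (j x)|%N = n.+1 >].
have /ex_minnP[n /asboolP[g gb gn] n_min] : exists n, P n.
  exists (`|coeff b (j x0)|%N.-1); apply/asboolP; exists x0 => //.
  by rewrite prednK // absz_gt0.
exists g; split=> // x xb; set d := coeff b (j g); set e := coeff b (j x).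
have d_neq0 : d != 0 by rewrite -absz_eq0 gn.
apply/dvdz_mod0P/eqP; apply: contrapT => /negP r_neq0.
have := n_min (`|(e %% d)%Z|%N.-1); rewrite leqNgt => /(_ _)/negP[].
  apply/asboolP; exists (x - g *~ (e %/ d)%Z).
    exact/belowB/belowMz.
  rewrite prednK ?absz_gt0 //; apply: (congr1 absz).
  rewrite !(raddfB, raddfMz) /= -/d -/e {1}(divz_eq e d).
  by rewrite -mulrzl intz; ring.
rewrite -ltnS -gn prednK ?absz_gt0 //.
by have := ltz_mod e d_neq0; rewrite -(gez0_abs (modz_ge0 e d_neq0)) abszE.
Qed.

(** Choosing for each [b] an element [g b] of [F], supported up to [b], whose
    coefficient at [b] generates the ideal of all such coefficients, the [g b]
    with nonzero coefficient at [b] form a basis.  They are independent because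
    their leading indices are distinct, and they span because subtracting a
    multiple of [g b] lowers the leading index, which cannot go on forever in a
    well-order. *)
Lemma free_abelian_sub : free_abelian F.
Proof.
have [g g_gen] := choice leading_gen.
pose lead b := coeff b (j (g b)).
pose K : choiceType := {b | lead b != 0}.
pose phi : {additive {freeg K / int} -> F} := extend (fun b : K => g (val b)).
exists K; apply: isomorphic_sym; apply: (@isomorphic_inj_surj _ _ phi).
- move=> c /(congr1 j); rewrite raddf0 => phi0; apply/eqP; rewrite -dom_eq0.
  apply: contrapT => /negP dom_neq0.
  have [m] : exists2 m : K, m \in dom c &
      {in dom c, forall b, R (val b) (val m)}.
    have [|m /mapP[k k_in ->] m_max] := @R_max (map val (dom c)).
      by rewrite -size_eq0 size_map size_eq0.
    by exists k => // b b_in; apply: m_max; exact: map_f.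
  rewrite mem_dom => m_neq0 m_max.
  (* At the largest index [m] only the basis element of [m] contributes. *)
  have /eqP := congr1 (coeff (val m)) phi0; rewrite coeff0 /= /phi extendE.
  rewrite !raddf_sum /= (bigD1_seq m) ?uniq_dom ?mem_dom //=.
  rewrite big1_seq => [|b /andP[bm b_in]]; last first.
    rewrite !raddfMz /=.
    have [->|gb] := eqVneq (coeff (val m) (j (g (val b)))) 0.
      by rewrite mul0rz.
    have mb := (g_gen (val b)).1 _ gb; case/eqP: bm; apply: val_inj.
    by apply: R_anti => //; exact: m_max.
  rewrite addr0 !raddfMz /= -mulrzl intz mulf_eq0 (negPf m_neq0) /=.
  by rewrite (negPf (valP m)).
- suff surj b : forall x, below b x -> exists c, phi c = x.
    move=> x; have [x0|/eqP x_neq0] := pselect (dom (j x) = [::]).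
      exists 0; rewrite raddf0; apply/esym/j_inj/eqP.
      by rewrite -dom_eq0 x0.
    have [m _ m_max] := R_max x_neq0.
    by apply: (surj m) => c c_in; apply: m_max; rewrite mem_dom.
  apply: contrapT => bad; have [|m {b bad}] := @R_min
      (fun b => ~ forall x, below b x -> exists c, phi c = x).
    by exists b.
  move=> m_bad m_min; apply: m_bad => x xm.
  (* [y] is what remains of [x] once its coefficient at [m] is cancelled. *)
  have [y [c yc] ym] : exists2 y, (exists c, phi c = x - y) &
      below m y /\ coeff m (j y) = 0.
    have [gm0|gm_neq0] := eqVneq (lead m) 0.
      exists x; first by exists 0; rewrite subrr raddf0.
      split=> //; apply/eqP; rewrite -dvd0z.
      by have := (g_gen m).2 x xm; rewrite -/(lead m) gm0.
    have /dvdzP[k xk] := (g_gen m).2 x xm.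
    exists (x - g m *~ k); last split.
    - exists << k *g (exist _ m gm_neq0 : K) >>.
      by rewrite opprB addrC subrK /phi /= extendZ.
    - by apply: belowB => //; apply: belowMz; exact: (g_gen m).1.
    - by rewrite !(raddfB, raddfMz) /= xk -mulrzl intz mulrN subrr.
  have [d yd] : exists d, phi d = y.
    have [y0|/eqP y_neq0] := pselect (dom (j y) = [::]).
      exists 0; rewrite raddf0; apply/esym/j_inj/eqP.
      by rewrite -dom_eq0 y0.
    have [b b_in b_max] := R_max y_neq0.
    apply: contrapT => y_bad.
    have mb : R m b.
      apply: m_min => b_good; apply: y_bad; apply: b_good => e e_in.
      by apply: b_max; rewrite mem_dom.
    move: b_in; rewrite mem_dom => b_neq0.
    have bm : R b m by exact: ym.1.
    by case/eqP: b_neq0; rewrite (R_anti bm mb); exact: ym.2.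
  by exists (c + d); rewrite raddfD /= yc yd subrK.
Qed.

End SubgroupOfFree.

Section AdditiveImage.
Variables (U V : zmodType) (f : {additive U -> V}).

Definition image_pred : {pred V} := fun v => `[< exists u, f u = v >].

Lemma image_pred_closed : zmod_closed image_pred.
Proof.
split=> [|v w]; rewrite !unfold_in.
  by apply/asboolP; exists 0; rewrite raddf0.
move=> /asboolP[u <-] /asboolP[u' <-]; apply/asboolP.
by exists (u - u'); rewrite raddfB.
Qed.

HB.instance Definition _ := GRing.isZmodClosed.Build V image_pred
  image_pred_closed.

Record additive_image := AdditiveImage {
  image_val : V;
  _ : image_pred image_val
}.

HB.instance Definition _ := [isSub for image_val].
HB.instance Definition _ := [Choice of additive_image by <:].
HB.instance Definition _ := [SubChoice_isSubZmodule of additive_image by <:].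

End AdditiveImage.

(** The image of [delta] is free as a subgroup of a free group, so [delta] has
    a section over it. *)
Lemma split_extension (G H : zmodType) (B : choiceType)
    (iota : {additive G -> H}) (delta : {additive H -> {freeg B / int}}) :
    (forall u, iota u = 0 -> u = 0) -> (forall u, delta (iota u) = 0) ->
    (forall h, delta h = 0 -> exists u, iota u = h) ->
  exists F : zmodType, free_abelian F /\ isomorphic H (G * F)%type.
Proof.
move=> iota_inj delta_iota delta_ker.
have val_inj0 (x : additive_image delta) : val x = 0 -> x = 0.
  by move=> x0; apply: val_inj; rewrite x0.
have [K /isomorphic_sym[g g_bij]] :=
  @free_abelian_sub _ _ (val : {additive _ -> _}) val_inj0.
have /choice[h hE] (b : K) : exists u, delta u = val (g << b >>).
  by case: (g << b >>) => v /= /asboolP.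
have delta_h c : delta (extend h c) = val (g c).
  move: c; apply: (@freeg_additive_ext _ _ (delta \o extend h) (val \o g)) => b.
  by rewrite /= extendU hE.
(* The image is represented by the free group on its basis [K]. *)
exists {freeg K / int}; split.
  exists K; exists (idfun : {additive _ -> _}).
  exact: (Bijective (fun=> erefl)).
pose phi (x : G * {freeg K / int}) := iota x.1 + extend h x.2.
have phi_additive : zmod_morphism phi.
  by move=> x y; rewrite /phi !raddfB /= addrACA opprD.
pose PhiA := GRing.isZmodMorphism.Build _ _ phi phi_additive.
pose Phi : {additive G * {freeg K / int} -> H} := HB.pack phi PhiA.
apply: isomorphic_sym; apply: (@isomorphic_inj_surj _ _ Phi) => [[u c]|v].
  rewrite /= /phi /= => uc0; have c0 : c = 0.
    apply: (bij_inj g_bij); rewrite raddf0; apply: val_inj0.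
    by rewrite -delta_h -[LHS]add0r -(delta_iota u) -raddfD uc0 raddf0.
  by move: uc0; rewrite c0 raddf0 addr0 => /iota_inj ->.
have v_im : image_pred delta (delta v) by apply/asboolP; exists v.
have [f _ gK] := g_bij; pose c := f (AdditiveImage v_im).
have [|u uE] := delta_ker (v - extend h c).
  by rewrite raddfB /= delta_h /c gK subrr.
by exists (u, c); rewrite /= /phi /= uE subrK.
Qed.

(** * Homology and simplicial maps *)

Section HomologyClass.
Variables (S : simplicial_set) (n : nat).

HB.instance Definition _ := GRing.isZmodMorphism.Build (cycles S n) (chain S n)
  (@cycle_val S n) (raddfB (val : cycles S n -> chain S n)).

Definition homology_class (z : cycles S n) : homology S n :=
  \pi_(Quotient.quot (@boundary_pred S n)) z.

Lemma homology_class_is_zmod_morphism : zmod_morphism homology_class.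
Proof. exact: raddfB. Qed.

HB.instance Definition _ := GRing.isZmodMorphism.Build _ _ homology_class
  homology_class_is_zmod_morphism.

Lemma homology_class_surj u : exists z, homology_class z = u.
Proof. by exists (repr u); rewrite /homology_class reprK. Qed.

Lemma homology_class_eq0 z :
  homology_class z = 0 <-> exists c : chain S n.+1, boundary c = z.
Proof.
have -> : homology_class z = 0 <-> z \in @boundary_pred S n.
  rewrite -[z in z \in _]subr0 Quotient.idealrBE.
  rewrite -/(homology_class z) -/(homology_class 0) raddf0.
  by split=> [/eqP|/eqP].
by rewrite unfold_in; split=> /asboolP.
Qed.

(** Universal property of homology as a quotient of the group of cycles. *)
Lemma homology_desc (M : zmodType) (f : {additive cycles S n -> M}) :
  (forall z, homology_class z = 0 -> f z = 0) ->
  exists g : {additive homology S n -> M}, forall z, g (homology_class z) = f z.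
Proof.
move=> f0; pose g (u : homology S n) := f (repr u).
have g_class z : g (homology_class z) = f z.
  apply/subr0_eq; rewrite -raddfB f0 // raddfB /= /homology_class reprK.
  by rewrite subrr.
have g_additive : zmod_morphism g.
  move=> u v; have [z <-] := homology_class_surj u.
  by have [w <-] := homology_class_surj v; rewrite -raddfB !g_class raddfB.
pose G := GRing.isZmodMorphism.Build _ _ g g_additive.
by exists (HB.pack g G : {additive homology S n -> M}).
Qed.

End HomologyClass.

Lemma cycleP (S : simplicial_set) n (z : cycles S n.+1) :
  boundary (z : chain S n.+1) = 0.
Proof. by case: z => z /= /eqP. Qed.

Lemma cycle_of (S : simplicial_set) n (c : chain S n.+1) :
  boundary c = 0 -> exists z : cycles S n.+1, z = c :> chain S n.+1.
Proof. by move=> /eqP c0; exists (@Cycles S n.+1 c c0). Qed.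

Record simplicial_map (S S' : simplicial_set) := SimplicialMap {
  smap :> forall n, S n -> S' n;
  smap_face : forall n (i : 'I_n.+2) (s : S n.+1),
    smap (face i s) = face i (smap s);
  smap_degen : forall n (i : 'I_n.+1) (s : S n),
    smap (degen i s) = degen i (smap s)
}.

Section InducedMap.
Variables (S S' : simplicial_set) (f : simplicial_map S S').

Lemma boundary_push n (c : chain S n.+1) :
  boundary (push (@f n.+1) c : chain S' n.+1) = push (@f n) (boundary c).
Proof.
move: c; apply: (@freeg_additive_ext _ (chain S' n)
  (@boundary S' n \o push (@f n.+1)) (push (@f n) \o @boundary S n)) => s.
rewrite /= pushU !boundaryU raddf_sum; apply: eq_bigr => i _ /=.
by rewrite /push extendZ freegU_mulz mul1r intz smap_face.
Qed.

Lemma push_cycle_subproof n (z : cycles S n) :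
  cycle_pred (push (@f n) (cycle_val z) : chain S' n).
Proof.
case: n z => [|n] z //; apply/eqP.
by rewrite boundary_push cycleP raddf0.
Qed.

Definition push_cycle n (z : cycles S n) : cycles S' n :=
  Cycles (push_cycle_subproof z).

Lemma push_cycle_is_zmod_morphism n : zmod_morphism (@push_cycle n).
Proof. by move=> z w; apply: val_inj; rewrite /= !raddfB. Qed.

HB.instance Definition _ n := GRing.isZmodMorphism.Build _ _ (@push_cycle n)
  (@push_cycle_is_zmod_morphism n).

Lemma homology_map n : exists g : {additive homology S n -> homology S' n},
  forall z, g (homology_class z) = homology_class (push_cycle z).
Proof.
apply: (homology_desc
  (f := (@homology_class S' n \o @push_cycle n : {additive _ -> _}))).
move=> z /homology_class_eq0[c cz]; apply/homology_class_eq0 => /=.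
by exists (push (@f n.+1) c); rewrite boundary_push cz.
Qed.

End InducedMap.

(** * Gluing vertices of a simplicial set *)

Lemma sum_alternating (K : choiceType) (x : K) n :
  \sum_(i < n.+2) << (-1) ^+ i *g x >> = << x >> *+ odd n :> {freeg K / int}.
Proof.
under eq_bigr do rewrite -[_ ^+ _]intz -freegU_mulz.
rewrite -mulrz_sumr.
suff -> : \sum_(i < n.+2) (-1) ^+ i = (odd n)%:Z :> int by [].
elim: n => [|n IH]; first by rewrite !big_ord_recl big_ord0.
by rewrite big_ord_recr /= IH -signr_odd /=; case: (odd n).
Qed.

Section Constant.
Variable S : simplicial_set.

Fixpoint const_simplex n (e : S 0) : S n :=
  if n is m.+1 then degen ord0 (const_simplex m e) else e.

Fixpoint vertex0 n : S n -> S 0 :=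
  if n is m.+1 then fun s => vertex0 (face ord_max s) else id.

Lemma face_const n (i : 'I_n.+2) e :
  face i (const_simplex n.+1 e) = const_simplex n e.
Proof.
elim: n i => [|n IH] i.
  by apply: face_degen_eq; case: i => [[|[]]].
have [i_le1|i_gt1] := leqP i 1%N.
  by apply: face_degen_eq; case: i i_le1 => [[|[]]].
have i0 : (i.-1 < n.+2)%N by rewrite -ltnS prednK ?ltn_ord // ltnW.
pose i' : 'I_n.+2 := Ordinal i0.
have -> : i = lift ord0 i'.
  by apply: val_inj; rewrite /= /bump leq0n add1n prednK // ltnW.
have -> : const_simplex n.+2 e =
    degen (widen_ord (leqnSn _) ord0) (const_simplex n.+1 e).
  by rewrite /=; congr degen; exact: val_inj.
by rewrite face_degen_gt ?IH // /i' /= -ltnS prednK // ltnW.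
Qed.

Lemma vertex0_const n e : vertex0 (const_simplex n e) = e.
Proof.
by elim: n => // n IH; rewrite [LHS]/= -/(const_simplex n.+1 e) face_const.
Qed.

(** All the faces of a constant simplex are equal, so they cancel in pairs; one
    is left over when their number [n + 2] is odd. *)
Lemma boundary_const n (c : chain S 0) :
  boundary (push (const_simplex n.+1) c : chain S n.+1) =
  push (const_simplex n) c *+ odd n.
Proof.
have -> : push (const_simplex n) c *+ odd n =
    extend (fun e => << const_simplex n e >> *+ odd n) c.
  rewrite /push !extendE -sumrMnl; apply: eq_bigr => e _.
  by case: (odd n); rewrite ?mulr1n // !mulr0n mul0rz.
move: c; apply: (@freeg_additive_ext _ (chain S n)
  (@boundary S n \o push (const_simplex n.+1))
  (extend (fun e => << const_simplex n e >> *+ odd n))) => e.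
rewrite /= extendU pushU boundaryU.
under eq_bigr do rewrite face_const mul1r.
exact: sum_alternating.
Qed.

End Constant.

Section GluingVertices.
Variables (S S' : simplicial_set) (q : simplicial_map S S').
Hypothesis q_surj : forall n (t : S' n), exists s, q n s = t.
(** By symmetry [t] is constant too when [s] and [t] differ: only vertices,
    with their degeneracies, are glued. *)
Hypothesis q_glue : forall n (s t : S n), q n s = q n t ->
  s = t \/ exists e, s = const_simplex n e.

Lemma smap_vertex0 n (s : S n) : q 0 (vertex0 s) = vertex0 (q n s).
Proof. by elim: n s => //= n IH s; rewrite IH smap_face. Qed.

Lemma smap_const n (e : S 0) :
  q n (const_simplex n e) = const_simplex n (q 0 e).
Proof. by elim: n => //= n IH; rewrite smap_degen IH. Qed.

Lemma push_section n : exists r : {additive chain S' n -> chain S n},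
  forall c, push (q n) (r c) = c.
Proof.
have [r qr] := choice (@q_surj n).
exists (push r : {additive _ -> _}) => c /=.
by rewrite push_comp push_id // => t _; exact: qr.
Qed.

(** A simplex that is not constant is alone in its fibre, so its coefficient
    survives in the image of the chain; hence only constant simplices occur in
    the kernel.  The witness [k0] is the image of [k] under first vertices, an
    operation that commutes with [q]. *)
Lemma glue_kernel n (k : chain S n) : push (q n) k = 0 ->
  exists2 k0 : chain S 0, k = push (const_simplex n) k0 & push (q 0) k0 = 0.
Proof.
move=> qk; exists (push (@vertex0 S n) k); last first.
  rewrite push_comp; have -> : q 0 \o @vertex0 S n = @vertex0 S' n \o q n.
    by apply: funext => s /=; rewrite smap_vertex0.
  by rewrite -push_comp qk raddf0.
rewrite push_comp push_id // => s s_in.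
suff [e ->] : exists e, s = const_simplex n e by rewrite /= vertex0_const.
apply: contrapT => s_nconst; have := congr1 (coeff (q n s)) qk.
rewrite coeff0 /push extendE raddf_sum /= (bigD1_seq s) ?uniq_dom //=.
rewrite big1 => [|t ts].
  rewrite addr0 raddfMz /= coeffU eqxx mul1r intz => /eqP.
  by apply/negP; rewrite -mem_dom.
rewrite raddfMz /= coeffU mul1r; case: eqP => [E|]; last by rewrite mul0rz.
case: (q_glue (esym E)) => // st; by rewrite st eqxx in ts.
Qed.

(** Hence the kernel in degree 0 is its own [H_0], and the connecting map, which
    takes the boundary of a lift, does not depend on the lift. *)
Lemma boundary_glue_kernel1 (k : chain S 1) :
  push (q 1) k = 0 -> boundary k = 0.
Proof.
by move=> /glue_kernel[k0 -> _]; rewrite boundary_const mulr0n.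
Qed.

(** In even degree [n + 1] the boundary is injective on the kernel, so [k = 0];
    in odd degree [n + 1] the boundary from the next degree is onto. *)
Lemma glue_kernel_acyclic n (k : chain S n.+1) :
    push (q n.+1) k = 0 -> boundary k = 0 ->
  exists2 k' : chain S n.+2, push (q n.+2) k' = 0 & boundary k' = k.
Proof.
move=> /glue_kernel[k0 -> k0_ker]; rewrite boundary_const.
(* For [n] odd, [k0] is recovered from the boundary by taking vertices. *)
have [n_odd|n_even] := boolP (odd n).
  rewrite mulr1n => /(congr1 (push (@vertex0 S n))).
  rewrite push_comp push_id => [|e _]; last exact: vertex0_const.
  by move=> ->; exists 0; rewrite !raddf0.
move=> _; exists (push (const_simplex n.+2) k0); last first.
  by rewrite boundary_const /= n_even mulr1n.
rewrite push_comp.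
have -> : q n.+2 \o const_simplex n.+2 = @const_simplex S' n.+2 \o q 0.
  by apply: funext => e; rewrite /= smap_const.
by rewrite -push_comp k0_ker raddf0.
Qed.

Lemma glue_homology_inj n (z : cycles S n.+1) :
  homology_class (push_cycle q z) = 0 -> homology_class z = 0.
Proof.
move=> /homology_class_eq0[c /= cz]; apply/homology_class_eq0.
have [r qr] := push_section n.+2.
have [||k qk rk] := @glue_kernel_acyclic n (cycle_val z - boundary (r c)).
- by rewrite raddfB /= -boundary_push qr cz subrr.
- by rewrite raddfB /= cycleP boundary_boundary subrr.
by exists (k + r c); rewrite raddfD /= rk subrK.
Qed.

(** A cycle [z] of the quotient lifts to a cycle as soon as the boundary of
    some lift of [z], which lies in the kernel, bounds in the kernel. *)
Lemma glue_homology_lift n (z : cycles S' n.+1)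
    (r : {additive chain S' n.+1 -> chain S n.+1})
    (qr : forall c, push (q n.+1) (r c) = c) :
    (exists2 k : chain S n.+1, push (q n.+1) k = 0 &
       boundary k = boundary (r (cycle_val z))) ->
  exists w : cycles S n.+1, homology_class (push_cycle q w) = homology_class z.
Proof.
move=> [k qk kz]; have [|w wE] := @cycle_of S n (r (cycle_val z) - k).
  by rewrite raddfB /= kz subrr.
exists w; congr homology_class; apply: val_inj => /=.
by rewrite wE raddfB /= qk subr0 qr.
Qed.

Lemma glue_homology n : isomorphic (homology S n.+2) (homology S' n.+2).
Proof.
have [f fE] := homology_map q n.+2.
apply: (@isomorphic_inj_surj _ _ f) => [u|v].
  by have [z <-] := homology_class_surj u; rewrite fE => /glue_homology_inj.
have [z <-] := homology_class_surj v.
have [r qr] := push_section n.+2.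
have [|w <-] := glue_homology_lift (z := z) qr.
  apply: glue_kernel_acyclic; last exact: boundary_boundary.
  by rewrite -boundary_push qr cycleP.
by exists (homology_class w); rewrite fE.
Qed.

(** The obstruction to lifting a class of [H_1] is the connecting map [delta],
    which takes values in the free group of chains of degree 0 and whose kernel
    is the image of [H_1] of [S]. *)
Lemma glue_homology1 : exists F : zmodType, free_abelian F /\
  isomorphic (homology S' 1) (homology S 1 * F)%type.
Proof.
have [r qr] := push_section 1.
(* The boundary of a lift: the connecting map before passing to classes. *)
pose d : {additive cycles S' 1 -> chain S 0} :=
  @boundary S 0 \o (r \o @cycle_val S' 1).
have [|delta deltaE] := @homology_desc S' 1 _ d.
  move=> z /homology_class_eq0[c cz]; rewrite /d /= -cz.
  have [r2 qr2] := push_section 2.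
  rewrite -[X in boundary X](subrK (boundary (r2 c))) raddfD /=.
  rewrite boundary_boundary addr0; apply: boundary_glue_kernel1.
  by rewrite raddfB /= qr -boundary_push qr2 subrr.
have ker_delta u : delta u = 0 ->
    exists w : cycles S 1, homology_class (push_cycle q w) = u.
  have [z <-] := homology_class_surj u; rewrite deltaE => dz.
  by apply: (glue_homology_lift qr); exists 0; rewrite ?raddf0 // -dz.
have [iota iotaE] := homology_map q 1.
apply: (@split_extension _ _ _ iota delta) => [u|u|u].
- by have [z <-] := homology_class_surj u; rewrite iotaE => /glue_homology_inj.
- have [z <-] := homology_class_surj u; rewrite iotaE deltaE /d /=.
  have : boundary (r (push (q 1) (cycle_val z)) - cycle_val z) = 0.
    by apply: boundary_glue_kernel1; rewrite raddfB /= qr subrr.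
  by rewrite raddfB /= cycleP subr0.
- by move=> /ker_delta[w <-]; exists (homology_class w); rewrite iotaE.
Qed.

End GluingVertices.

(** * Homology of a disjoint union *)

Section Coproduct.
Variables (I : Type) (S : I -> simplicial_set).

Definition coproduct_simplex n : Type := {a : I & S a n}.

HB.instance Definition _ n := gen_eqMixin (coproduct_simplex n).
HB.instance Definition _ n := gen_choiceMixin (coproduct_simplex n).

Definition coproduct : simplicial_set.
Proof.
refine (@SimplicialSet (fun n => coproduct_simplex n)
  (fun n i s => existT _ (projT1 s) (face i (projT2 s)))
  (fun n i s => existT _ (projT1 s) (degen i (projT2 s))) _ _ _ _ _) =>
  n i j [a s] /= ij; congr existT.
- exact: face_face.
- exact: face_degen_lt.
- exact: face_degen_eq.
- exact: face_degen_gt.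
- exact: degen_degen.
Defined.

Definition inclusion (a : I) : simplicial_map (S a) coproduct.
Proof.
by refine (@SimplicialMap (S a) coproduct (fun n s => existT _ a s) _ _).
Defined.

(** The chain [s] if the simplex [s] lies in [S a], and 0 otherwise; this
    retraction onto one summand exists on chains but not on simplices. *)
Definition component_of (a : I) n (s : coproduct n) : chain (S a) n :=
  match pselect (projT1 s = a) with
  | left e => << eq_rect _ (fun b => S b n) (projT2 s) _ e >>
  | right _ => 0
  end.

Definition projection (a : I) n : chain coproduct n -> chain (S a) n :=
  extend (@component_of a n).

HB.instance Definition _ a n := GRing.Additive.on (@projection a n).

Lemma component_of_inclusion a n (s : S a n) :
  component_of a (inclusion a n s) = << s >>.
Proof.
rewrite /component_of; case: pselect => //= e.
by rewrite (Prop_irrelevance e erefl).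
Qed.

Lemma component_of_neq a b n (s : S b n) : b <> a ->
  component_of a (inclusion b n s) = 0.
Proof. by move=> ba; rewrite /component_of; case: pselect. Qed.

Lemma projection_inclusion a n (c : chain (S a) n) :
  projection a (push (inclusion a n) c : chain coproduct n) = c.
Proof.
move: c; apply: (@freeg_additive_ext _ (chain (S a) n)
  (@projection a n \o push (inclusion a n)) idfun) => s.
by rewrite /= pushU /projection extendU component_of_inclusion.
Qed.

Lemma projection_inclusion_neq a b n (c : chain (S b) n) : b <> a ->
  projection a (push (inclusion b n) c : chain coproduct n) = 0.
Proof.
move=> ba; move: c; apply: (@freeg_additive_ext _ (chain (S a) n)
  (@projection a n \o push (inclusion b n)) \0) => s.
by rewrite /= pushU /projection extendU component_of_neq.
Qed.

Lemma boundary_projection a n (c : chain coproduct n.+1) :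
  boundary (projection a c) = projection a (boundary c).
Proof.
move: c; apply: (@freeg_additive_ext _ (chain (S a) n)
  (@boundary (S a) n \o @projection a n.+1)
  (@projection a n \o @boundary coproduct n)) => -[b s].
rewrite /= /projection extendU boundaryU raddf_sum /=.
under eq_bigr do rewrite mul1r extendZ.
have [<-|ba] := pselect (b = a).
  rewrite (component_of_inclusion s) boundaryU; apply: eq_bigr => i _.
  by rewrite (component_of_inclusion (face i s)) freegU_mulz mul1r intz.
rewrite (component_of_neq s ba) raddf0 big1 // => i _.
by rewrite (component_of_neq (face i s) ba) mul0rz.
Qed.

Lemma sum_projection n (c : chain coproduct n) (r : seq {classic I}) :
    uniq r -> {in dom c, forall s, (projT1 s : {classic I}) \in r} ->
  \sum_(a <- r) push (inclusion a n) (projection a c) = c.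
Proof.
move=> r_uniq c_r; rewrite -[in RHS](freeg_sumE c).
under eq_bigr do rewrite /projection extendE raddf_sum /=.
rewrite exchange_big /=; apply: eq_big_seq => -[b s] /c_r /= b_r.
rewrite (bigD1_seq (b : {classic I})) //= big1 => [|a /eqP ab].
  by rewrite addr0 raddfMz /= (component_of_inclusion s) pushU freegU_mulz intz.
by rewrite (@component_of_neq a b) ?mul0rz ?raddf0 // => ba; apply: ab.
Qed.

Lemma projection_cycle_subproof a n (z : cycles coproduct n) :
  cycle_pred (projection a (cycle_val z)).
Proof.
case: n z => [|n] z //; apply/eqP.
by rewrite boundary_projection cycleP raddf0.
Qed.

Definition projection_cycle a n (z : cycles coproduct n) : cycles (S a) n :=
  Cycles (projection_cycle_subproof a z).

Lemma projection_cycle_is_zmod_morphism a n :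
  zmod_morphism (@projection_cycle a n).
Proof. by move=> z w; apply: val_inj; rewrite /= !raddfB. Qed.

HB.instance Definition _ a n := GRing.isZmodMorphism.Build _ _
  (@projection_cycle a n) (@projection_cycle_is_zmod_morphism a n).

Definition tags n (c : chain coproduct n) : seq {classic I} :=
  undup [seq (projT1 s : {classic I}) | s <- dom c].

Lemma sum_projection_tags n (c : chain coproduct n) :
  \sum_(a <- tags c) push (inclusion a n) (projection a c) = c.
Proof.
apply: sum_projection; first exact: undup_uniq.
by move=> s s_in; rewrite mem_undup; exact: map_f.
Qed.

Lemma projection_finite n (z : cycles coproduct n) :
  finite_set [set a | homology_class (projection_cycle a z) != 0].
Proof.
apply: (@sub_finite_set _ _ [set` tags (cycle_val z)]); last first.
  exact: (@finite_seq {classic I}).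
move=> a /=; apply: contraR => a_notin; apply/eqP.
rewrite (_ : projection_cycle a z = 0) ?raddf0 //; apply: val_inj => /=.
rewrite /projection extendE big_seq big1 // => s s_in.
rewrite /component_of; case: pselect => [sa|]; last by rewrite mul0rz.
by case/negP: a_notin; rewrite mem_undup -sa; exact: map_f.
Qed.

Definition projection_classes n (z : cycles coproduct n) :
    direct_sum (fun a => homology (S a) n) :=
  DirectSum (projection_finite z).

Lemma projection_classes_is_zmod_morphism n :
  zmod_morphism (@projection_classes n).
Proof. by move=> z w; apply: direct_sumP => a /=; rewrite !raddfB. Qed.

HB.instance Definition _ n := GRing.isZmodMorphism.Build _ _
  (@projection_classes n) (@projection_classes_is_zmod_morphism n).

(** Every chain is the sum of its finitely many projections, and these commute
    with boundaries, so cycles and boundaries can be tested and built summand by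
    summand. *)
Lemma homology_coproduct n :
  isomorphic (homology coproduct n) (direct_sum (fun a => homology (S a) n)).
Proof.
have [|f fE] := @homology_desc coproduct n _ (@projection_classes n).
  move=> z /homology_class_eq0[c cz]; apply: direct_sumP => a /=.
  apply/homology_class_eq0; exists (projection a c).
  by rewrite boundary_projection cz.
apply: (isomorphic_inj_surj (f := f)) => [u|v].
  have [z <-] := homology_class_surj u; rewrite fE => z0.
  have fill a : exists c : chain (S a) n.+1,
      boundary c = projection a (cycle_val z).
    apply/(homology_class_eq0 (projection_cycle a z)).
    by have := congr1 (fun v : direct_sum _ => v a) z0.
  pose c a := sval (cid (fill a)).
  have cz a : boundary (c a) = projection a (cycle_val z).
    exact: svalP (cid (fill a)).
  apply/homology_class_eq0.
  exists (\sum_(a <- tags (cycle_val z)) push (inclusion a n.+1) (c a)).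
  rewrite raddf_sum -[RHS]sum_projection_tags; apply: eq_bigr => a _ /=.
  by rewrite -cz; exact: (boundary_push (inclusion a)).
pose z a := sval (cid (homology_class_surj (v a))).
have zE a : homology_class (z a) = v a.
  exact: svalP (cid (homology_class_surj (v a))).
have [r r_uniq rE] : exists2 r : seq {classic I}, uniq r &
    forall a : {classic I}, v a != 0 -> a \in r.
  have /(@finite_seqP {classic I})[r rE] := dsum_finite v.
  exists (undup r); first exact: undup_uniq.
  by move=> a a_neq0; rewrite mem_undup; have := congr1 (@^~ a) rE => /= <-.
exists (homology_class (\sum_(a <- r) push_cycle (inclusion a) (z a))).
rewrite fE; apply: direct_sumP => b /=; rewrite !raddf_sum /=.
have part a :
    homology_class (projection_cycle b (push_cycle (inclusion a) (z a))) =
    if (a : {classic I}) == b then v b else 0.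
  case: eqP => [->|ab].
    rewrite -zE; congr homology_class; apply: val_inj.
    exact: projection_inclusion.
  rewrite (_ : projection_cycle _ _ = 0) ?raddf0 //; apply: val_inj.
  exact: projection_inclusion_neq.
under eq_bigr do rewrite part.
have [b_r|b_r] := boolP ((b : {classic I}) \in r).
  rewrite (bigD1_seq (b : {classic I})) //= eqxx big1 ?addr0 // => a.
  by move=> /negPf ->.
rewrite big1_seq => [|a /andP[_ a_r]].
  by apply/esym/eqP; apply: contraNT b_r => /rE.
by case: eqP a_r => // ->; rewrite (negPf b_r).
Qed.

End Coproduct.

(** * The nerve of a discrete atlas *)

Section ConstantStrings.
Variables (X : Type) (G : local_groupoid X).

Fixpoint const_string x (ox : obj G x) n : string G n x :=
  if n is m.+1 then existT _ x (gid ox, const_string ox m) else ox.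

Lemma const_simplexE x (ox : obj G x) n :
  const_simplex (S := groupoid_nerve G) n (existT _ x ox) =
  existT _ x (const_string ox n).
Proof.
elim: n => //= n ->; rewrite /simplex_degen /=; congr existT.
case: n => [|n]; first exact: (string_degen0 _ _ (ox : string G 0 x)).
exact: (string_degen0 _ _ (const_string ox n.+1)).
Qed.

End ConstantStrings.

Lemma trivial_string_const (X : Type) (z : X) n x
    (c : string (trivial_groupoid z) n x) (zx : obj (trivial_groupoid z) x) :
  c = const_string zx n.
Proof.
elim: n x c zx => [|n IH] x c zx; first exact: (@Prop_irrelevance (z = x)).
case: c => y [[ex ey] c]; case: _ / ex zx => zx; case: _ / ey c => c /=.
rewrite (IH _ c zx).
exact: (@string_degen0 X (trivial_groupoid z) n z erefl zx).
Qed.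

Lemma trivial_string_in (X : Type) (z : X) (P : set X) n x
  (c : string (trivial_groupoid z) n x) : P z -> string_in P c.
Proof.
move=> Pz; elim: n x c => [|n IH] x c; first by case: _ / c.
by case: c => y [[ex ey] c] /=; split; [case: _ / ex|exact: IH].
Qed.

(** Applied to the maps of an atlas from an index to itself. *)
Lemma string_map_id (X : Type) (G : local_groupoid X)
    (F : forall x y, obj G x -> obj G y -> Defs.hom G x y -> Defs.hom G x y) n x
    (c : string G n x) (cG : string_in (obj G) c) :
  (forall x y ox oy f, F x y ox oy f = f) -> string_map F cG = c.
Proof.
move=> F_id; elim: n x c cG => [|n IH] x c cG.
  exact: (@Prop_irrelevance (obj G x)).
by case: c cG => y [f c] [ox cG] /=; rewrite F_id IH.
Qed.

Section DiscreteAtlas.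
Variable A : groupoid_atlas.
Hypothesis discA : discrete_index A.

Lemma string_map_trivial z (a : atlas_index A) (zA : obj (atlas_local a) z) n x
    (c : string (trivial_groupoid z) n x)
    (cA : string_in (obj (atlas_local a)) c) (xA : obj (atlas_local a) x) :
  string_map (fun x y _ _ f => trivial_to_local zA f) cA = const_string xA n.
Proof.
elim: n x c cA xA => [|n IH] x c cA xA.
  exact: (@Prop_irrelevance (obj (atlas_local a) x)).
case: c cA => y [[ex ey] c] /= [xA' cA]; case: _ / ex xA xA' => xA xA'.
case: _ / ey c cA => c cA; rewrite (IH _ _ _ xA) /=.
by rewrite (gid_irr zA xA).
Qed.

Definition is_const n (u : local_simplex (regularization A) n) : Prop :=
  exists e, projT2 u =
    const_simplex (S := groupoid_nerve (atlas_local (projT1 u))) n e.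

(** By discreteness, a step either relates an index of [A] to itself, through
    the identity, or starts at an added one-point groupoid, all of whose strings
    are constant, and leads to their images. *)
Lemma simplex_step_const n (u v : local_simplex (regularization A) n) :
  simplex_step u v -> u = v \/ is_const u /\ is_const v.
Proof.
case=> -[a|z] [b|w] ab x c cb //=.
- left; have E := discA ab; move: ab cb; case: _ / E => ab cb.
  by rewrite string_map_id // => x' y' ox oy f; exact: atlas_map_refl.
- right; have zx : z = x by have := string_src c.
  split.
    exists (existT _ x zx).
    by rewrite const_simplexE /= -(trivial_string_const c).
  move: ab cb; case: _ / zx c => c ab cb; exists (existT _ z ab).
  by rewrite const_simplexE /= -(string_map_trivial ab cb ab).
- right; split.
    have zx : z = x by have := string_src c.
    exists (existT _ x zx).
    by rewrite const_simplexE /= -(trivial_string_const c).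
  have wx : w = x by have := string_in_src cb.
  exists (existT _ x wx); rewrite const_simplexE.
  by congr existT; exact: trivial_string_const.
Qed.

Lemma simplex_equiv_const n (u v : local_simplex (regularization A) n) :
  simplex_equiv u v -> u = v \/ is_const u /\ is_const v.
Proof.
move=> /asboolP; elim=> {u v}.
- by move=> u v /simplex_step_const.
- by left.
- by move=> u v _ [->|[]]; [left|right].
- by move=> u v w _ [->|[cu cv]] _ [<-|[cv' cw]]; auto.
Qed.

Definition local_nerves : simplicial_set :=
  coproduct (fun a : atlas_index A => groupoid_nerve (atlas_local a)).

Definition nerve_quotient_fun n (s : local_nerves n) : nerve A n :=
  \pi_(atlas_simplex (regularization A) n)
    (existT (fun a => simplex (reg_local a) n) (inl (projT1 s)) (projT2 s)).

Definition nerve_quotient : simplicial_map local_nerves (nerve A).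
Proof.
refine (@SimplicialMap local_nerves (nerve A) nerve_quotient_fun _ _) => n i s.
- by rewrite [RHS]pi_atlas_face.
- by rewrite [RHS]pi_atlas_degen.
Defined.

(** The simplices of an added one-point groupoid are identified with constant
    simplices of a local groupoid, because the atlas is covered. *)
Lemma nerve_quotient_surj n (t : nerve A n) : exists s, nerve_quotient n s = t.
Proof.
elim/quotW: t => -[[a|z] s]; first by exists (existT _ a s).
have [a az] := atlas_cover z; case: s => x c.
have cA : string_in (obj (atlas_local a)) c by exact: trivial_string_in.
pose c' := string_map (reg_map (a := inr z) (b := inl a) az) cA.
exists (existT _ a (existT _ x c')).
apply/esym/eqmodP/asboolP/rst_step.
exact: (@SimplexStep (regularization A) n (inr z) (inl a) az x c cA).
Qed.

Lemma nerve_quotient_glue n (s t : local_nerves n) :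
  nerve_quotient n s = nerve_quotient n t ->
  s = t \/ exists e, s = const_simplex n e.
Proof.
case: s t => a s [b t] /eqmodP/simplex_equiv_const[st|[[e /= ->] _]].
  pose f (u : local_simplex (regularization A) n) : local_nerves n :=
    if u is existT (inl a') s' then existT _ a' s' else existT _ a s.
  left; exact: (congr1 f st).
right; pose nerves (b : atlas_index A) := groupoid_nerve (atlas_local b).
pose i := inclusion nerves a.
by exists (i 0 e); rewrite -smap_const.
Qed.

End DiscreteAtlas.

Theorem corollary5p6p6 (A : groupoid_atlas) (discA : discrete_index A) :
  (forall n : nat, (2 <= n)%N ->
     isomorphic (atlas_homology A n)
       (direct_sum (fun a : atlas_index A =>
          groupoid_homology (atlas_local a) n))) /\
  (exists F : zmodType, free_abelian F /\
     isomorphic (atlas_homology A 1)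
       (direct_sum (fun a : atlas_index A =>
          groupoid_homology (atlas_local a) 1) * F)%type).
Proof.
have surj := @nerve_quotient_surj A.
have glue := nerve_quotient_glue discA.
pose sum_iso := homology_coproduct
  (fun a : atlas_index A => groupoid_nerve (atlas_local a)).
split=> [[|[|n]] //= _|].
  apply: isomorphic_trans (sum_iso n.+2).
  exact/isomorphic_sym/(glue_homology surj glue).
have [F [F_free F_iso]] := glue_homology1 surj glue.
exists F; split=> //; apply: isomorphic_trans F_iso _.
exact/isomorphic_prodl/(sum_iso 1).
Qed.
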